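(* Let $U\subset\mathbb{C}^{\times}$ be a set with $0\in\overline{U}$, and fix $\mathfrak{d}\in\mathbb{C}$. For each $\mathfrak{c}\in U$ let $X(s)=\mathfrak{c}s+\mathfrak{d}$. Let $\{\mathbf{u}_{\mathfrak{c}}:\mathfrak{c}\in U\}\subset\mathcal{P}'$ be a family of nonzero linear functionals such that, for every $\mathfrak{c}\in U$, $$\boldsymbol{\mathrm{D}}_{X}(\phi\,\mathbf{u}_{\mathfrak{c}})=\boldsymbol{\mathrm{S}}_{X}(\psi\,\mathbf{u}_{\mathfrak{c}}),$$ where $\phi(x)=ax^2+bx+c$ and $\psi(x)=dx+e$ are fixed polynomials (independent of $\mathfrak{c}$) with complex coefficients. Set $d_n=an+d$ and assume $d_n\neq 0$ for all $n\in\mathbb{N}$. Assume (after scaling each $\mathbf{u}_{\mathfrak{c}}$ by a nonzero complex constant) that $\langle\mathbf{u}_{\mathfrak{c}},1\rangle=1$ for all $\mathfrak{c}\in U$. Then there exists a unique functional $\mathbf{u}_0\in\mathcal{P}'$ such that $$\mathbf{u}_{\mathfrak{c}}\longrightarrow\mathbf{u}_0$$ in the weak topology $\sigma(\mathcal{P}',\mathcal{P})$ as $\mathfrak{c}\to 0$ within $U$. Moreover, for every $n\in\mathbb{N}$ the limit $$\mu_n=\lim_{\substack{\mathfrak{c}\to 0\\ \mathfrak{c}\in U}}\langle\mathbf{u}_{\mathfrak{c}},x^n\rangle$$ exists, is finite, and satisfies $\langle\mathbf{u}_0,x^n\rangle=\mu_n$.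
   Context: Notation: $\mathbb{N}=\{0,1,2,\dots\}$, $\mathbb{C}^{\times}=\mathbb{C}\setminus\{0\}$, $\overline{U}$ is the closure of $U$ in $\mathbb{C}$. The lattice slope $\mathfrak{c}$ is distinct from the coefficient $c$ of $\phi$. $\mathcal{P}=\mathbb{C}[x]$ is the space of complex polynomials, with the strict inductive limit topology of the finite-dimensional spaces $\mathcal{P}_n$ of polynomials of degree at most $n$; $\mathcal{P}'$ is its continuous dual (every linear functional on $\mathcal{P}$ is continuous), with pairing $\langle\cdot,\cdot\rangle$. The weak topology $\sigma(\mathcal{P}',\mathcal{P})$ is that of pointwise convergence on $\mathcal{P}$. For $p\in\mathcal{P}$, $\mathbf{u}\in\mathcal{P}'$, $p\mathbf{u}\in\mathcal{P}'$ is defined by $\langle p\mathbf{u},q\rangle=\langle\mathbf{u},pq\rangle$ for $q\in\mathcal{P}$. For a linear lattice $X(s)=\mathfrak{c}s+\mathfrak{d}$, $\mathfrak{c}\neq 0$, define on $\mathcal{P}$ $$(\mathrm{D}_Xp)(x)=\frac{p(x+\mathfrak{c}/2)-p(x-\mathfrak{c}/2)}{\mathfrak{c}},\qquad(\mathrm{S}_Xp)(x)=\frac{p(x+\mathfrak{c}/2)+p(x-\mathfrak{c}/2)}{2},$$ and on $\mathcal{P}'$, $\langle\boldsymbol{\mathrm{D}}_X\mathbf{u},p\rangle=-\langle\mathbf{u},\mathrm{D}_Xp\rangle$ and $\langle\boldsymbol{\mathrm{S}}_X\mathbf{u},p\rangle=\langle\mathbf{u},\mathrm{S}_Xp\rangle$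 for $p\in\mathcal{P}$. *)

(* Defs.v *)
From HB Require Import structures.
From mathcomp Require Import all_boot all_order all_algebra.
From mathcomp Require Import complex.
From mathcomp Require Import all_classical all_reals all_analysis.
Set Implicit Arguments.
Unset Strict Implicit.
Unset Printing Implicit Defensive.
Import Order.TTheory GRing.Theory Num.Theory.
Import numFieldNormedType.Exports.
Local Open Scope classical_set_scope.
Local Open Scope ring_scope.

(* The complex numbers, packed as a numClosedFieldType so that they carry the
   topology of the modulus (library instances on numeric fields) *)
Definition Cplx (R : realType) : numClosedFieldType := complex R.

(* Every linear functional on C[x] is continuous for the strict inductive limit
   topology, so the continuous dual P' is the space of all linear functionals. *)
Definition poly_dual (F : fieldType) := {scalar {poly F}}.

Record linlattice (F : fieldType) := LinLattice { slope : F; offset : F }.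

Definition lattice_fun (F : fieldType) (X : linlattice F) (s : F) : F :=
  slope X * s + offset X.

Coercion lattice_fun : linlattice >-> Funclass.

Section LatticeOperators.
Variable F : fieldType.
Implicit Types (X : linlattice F) (f p q : {poly F}) (u : poly_dual F).

Definition shiftp (h : F) p : {poly F} := p \Po ('X + h%:P).

Lemma shiftp_is_linear h : linear (shiftp h).
Proof. by move=> k p q; rewrite /shiftp comp_polyD comp_polyZ. Qed.

HB.instance Definition _ h :=
  GRing.isLinear.Build F {poly F} {poly F} *:%R (shiftp h) (shiftp_is_linear h).

Definition DX X p : {poly F} :=
  (slope X)^-1 *: (shiftp (slope X / 2) p - shiftp (- (slope X / 2)) p).

Definition SX X p : {poly F} :=
  2^-1 *: (shiftp (slope X / 2) p + shiftp (- (slope X / 2)) p).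

Lemma DX_is_linear X : linear (DX X).
Proof.
move=> k p q; rewrite /DX !shiftp_is_linear scalerA [k * _]mulrC -scalerA -[RHS]scalerDr.
by congr (_ *: _); rewrite scalerBr opprD addrACA.
Qed.

Lemma SX_is_linear X : linear (SX X).
Proof.
move=> k p q; rewrite /SX !shiftp_is_linear scalerA [k * _]mulrC -scalerA -[RHS]scalerDr.
by congr (_ *: _); rewrite scalerDr addrACA.
Qed.

HB.instance Definition _ X :=
  GRing.isLinear.Build F {poly F} {poly F} *:%R (DX X) (DX_is_linear X).
HB.instance Definition _ X :=
  GRing.isLinear.Build F {poly F} {poly F} *:%R (SX X) (SX_is_linear X).

Definition dual_mulp_fun f u : {poly F} -> F := fun q => u (f * q).
Definition dual_DX_fun X u : {poly F} -> F := fun p => - u (DX X p).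
Definition dual_SX_fun X u : {poly F} -> F := fun p => u (SX X p).

Lemma dual_mulp_is_scalar f u : scalar (dual_mulp_fun f u).
Proof. by move=> k p q; rewrite /dual_mulp_fun mulrDr -scalerAr linearP. Qed.

Lemma dual_DX_is_scalar X u : scalar (dual_DX_fun X u).
Proof. by move=> k p q; rewrite /dual_DX_fun !linearP /= opprD mulrN. Qed.

Lemma dual_SX_is_scalar X u : scalar (dual_SX_fun X u).
Proof. by move=> k p q; rewrite /dual_SX_fun !linearP. Qed.

HB.instance Definition _ f u :=
  GRing.isLinear.Build F {poly F} F *%R (dual_mulp_fun f u) (dual_mulp_is_scalar f u).
HB.instance Definition _ X u :=
  GRing.isLinear.Build F {poly F} F *%R (dual_DX_fun X u) (dual_DX_is_scalar X u).
HB.instance Definition _ X u :=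
  GRing.isLinear.Build F {poly F} F *%R (dual_SX_fun X u) (dual_SX_is_scalar X u).

Definition dual_mulp f u : poly_dual F := dual_mulp_fun f u.
Definition dual_DX X u : poly_dual F := dual_DX_fun X u.
Definition dual_SX X u : poly_dual F := dual_SX_fun X u.

End LatticeOperators.

Definition poly_dual_eval (C : numClosedFieldType) (u : poly_dual C) :
  {ptws {poly C} -> C} := fun p => u p.

(* P' is given the weak topology sigma(P', P): the topology induced by its
   embedding into the functions P -> C with the topology of pointwise
   convergence *)
HB.instance Definition _ (C : numClosedFieldType) :=
  Topological.copy (poly_dual C) (initial_topology (@poly_dual_eval C)).

(* Main.v *)
Require Import Defs.
From HB Require Import structures.
From mathcomp Require Import all_boot all_order all_algebra.
From mathcomp Require Import complex.
From mathcomp Require Import all_classical all_reals all_analysis.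
From mathcomp Require Import ring.
Set Implicit Arguments.
Unset Strict Implicit.
Unset Printing Implicit Defensive.
Import Order.TTheory GRing.Theory Num.Theory.
Import numFieldNormedType.Exports.
Local Open Scope classical_set_scope.
Local Open Scope ring_scope.

(** Testing the functional equation on a polynomial [p] says that
    [u s (phi * DX p + psi * SX p) = 0], where [s] is the slope of the lattice.
    For [p = 'X^n], the operators [DX] and [SX] are perturbations of the
    derivative and of the identity: the polynomial [phi * DX p + psi * SX p] has
    leading term [(a * n%:R + d) *: 'X^(n.+1)], with a coefficient that depends
    on [n] only, while its lower coefficients are polynomials in [s], hence
    converge as [s] tends to 0 ([cvg_polys_pearson]). Since [a * n%:R + d] is
    nonzero, the moment of order [n.+1] is a combination of the lower moments
    with convergent coefficients, and as the moment of order 0 is 1, all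
    moments converge by induction ([cvg_moments]).

    The coefficients of [DX 'X^n] and [SX 'X^n] are never written out: their
    convergence follows by induction from product rules for multiplication by
    ['X] ([DXMX], [SXMX]), through a class of polynomial families closed under
    the operations that occur in these rules ([cvg_polys]).

    The limits of the moments define the limit functional ([poly_dual_lim]).
    Weak convergence is convergence at every polynomial ([poly_dual_cvgP]), so
    uniqueness is that of limits in the scalar field, which applies because 0
    lies in the closure of [U]. *)

(** * Product rules for the difference and averaging operators *)

Section LatticeOperatorsOnMonomials.
Variable C : numClosedFieldType.
Implicit Types (X : linlattice C) (q : {poly C}).

Lemma shiftpMX h q : shiftp h ('X * q) = ('X + h%:P) * shiftp h q :> {poly C}.
Proof. by rewrite /shiftp comp_polyM comp_polyX. Qed.

Lemma shiftp1 h : shiftp h 1 = 1 :> {poly C}.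
Proof. by rewrite /shiftp comp_polyC. Qed.

Lemma DX1 X : DX X 1 = 0.
Proof. by rewrite /DX !shiftp1 subrr scaler0. Qed.

Lemma SX1 X : SX X 1 = 1.
Proof.
by rewrite /SX !shiftp1 -mul_polyC -polyC1 -polyCD -polyCM mulVf ?pnatr_eq0.
Qed.

(** Together with [SXMX], this lets [DX] and [SX] be computed on monomials by
    induction. The division by the slope is absorbed: in both rules the
    coefficients are polynomials in the slope, so they have limits at 0. *)
Lemma DXMX X q : slope X != 0 -> DX X ('X * q) = 'X * DX X q + SX X q.
Proof.
move=> s0; rewrite /DX /SX !shiftpMX.
set A := shiftp _ q; set B := shiftp _ q.
(* half the slope, added to 'X by the shift, becomes the weight of SX once
   divided by the slope *)
have half : 2^-1 = (slope X)^-1 * (slope X / 2) by rewrite mulrA mulVf ?mul1r.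
rewrite [in RHS]half -!mul_polyC !polyCM polyCN !polyCM; ring.
Qed.

Lemma SXMX X q :
  slope X != 0 -> SX X ('X * q) = 'X * SX X q + (slope X / 2) ^+ 2 *: DX X q.
Proof.
move=> s0; rewrite /DX /SX !shiftpMX scalerA.
set A := shiftp _ q; set B := shiftp _ q.
have -> : (slope X / 2) ^+ 2 / slope X = 2^-1 * (slope X / 2).
  by rewrite expr2 -mulrA mulrC [_ / 2]mulrC mulfK.
rewrite -!mul_polyC polyCN !polyCM; ring.
Qed.

End LatticeOperatorsOnMonomials.

(** * Families of polynomials of bounded degree with convergent coefficients *)

Section ConvergentPolynomialFamilies.
Variables (C : numClosedFieldType) (I : Type) (F : set_system I).
Hypothesis FF : Filter F.
Implicit Types (n : nat) (P Q : I -> {poly C}).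

(** The bound on the degree is uniform along the filter: it makes the value of a
    functional on [P s] a sum, with a fixed number of terms, of products of a
    coefficient by a moment. The families are only constrained near the filter,
    because [DXMX] fails at slope 0. *)
Definition cvg_polys n P :=
  (\forall s \near F, (size (P s) <= n)%N) /\
  forall k, cvg ((P s)`_k @[s --> F]).

Lemma near_cvg (f g : I -> C) :
  (\forall s \near F, f s = g s) -> cvg (g s @[s --> F]) -> cvg (f s @[s --> F]).
Proof.
move=> fg /cvg_ex[l gl]; apply/cvg_ex; exists l.
apply: cvg_trans gl; apply: near_eq_cvg.
by apply: filterS fg.
Qed.

Lemma near_cvg_polys n P Q :
  (\forall s \near F, P s = Q s) -> cvg_polys n Q -> cvg_polys n P.
Proof.
move=> PQ [sQ cQ]; split=> [|k]; first by apply: filterS2 PQ sQ => s ->.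
by apply: near_cvg (cQ k); apply: filterS PQ => s ->.
Qed.

Lemma cvg_polys_widen m n P : (m <= n)%N -> cvg_polys m P -> cvg_polys n P.
Proof.
by move=> mn [sP cP]; split=> //; apply: filterS sP => s /leq_trans; apply.
Qed.

Lemma cvg_polys_cst (q : {poly C}) : cvg_polys (size q) (fun=> q).
Proof. by split=> [|k]; [exact: nearW | exact: is_cvg_cst]. Qed.

Lemma cvg_polys_Xn n : cvg_polys n.+1 (fun=> 'X^n).
Proof. by have := cvg_polys_cst 'X^n; rewrite size_polyXn. Qed.

Lemma cvg_polysD n P Q :
  cvg_polys n P -> cvg_polys n Q -> cvg_polys n (fun s => P s + Q s).
Proof.
move=> [sP cP] [sQ cQ]; split=> [|k].
  apply: filterS2 sP sQ => s sP sQ.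
  by rewrite (leq_trans (size_polyD _ _))// geq_max sP.
under eq_fun do rewrite coefD.
exact: is_cvgD.
Qed.

Lemma cvg_polysZ n (l : I -> C) P :
  cvg (l s @[s --> F]) -> cvg_polys n P -> cvg_polys n (fun s => l s *: P s).
Proof.
move=> cl [sP cP]; split=> [|k].
  by apply: filterS sP => s; apply: leq_trans; exact: size_scale_leq.
under eq_fun do rewrite coefZ.
exact: is_cvgM.
Qed.

Lemma cvg_polysMX n P : cvg_polys n P -> cvg_polys n.+1 (fun s => 'X * P s).
Proof.
move=> [sP cP]; split=> [|k].
  apply: filterS sP => s sP; rewrite (leq_trans (size_polyMleq _ _))//.
  by rewrite size_polyX.
under eq_fun do rewrite coefXM.
by case: k => [|k] /=; [exact: is_cvg_cst|exact: cP].
Qed.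

(** Convergence of the moments of order less than [n] suffices, although the
    polynomials vary together with the functionals. *)
Lemma cvg_pairing n P (u : I -> {scalar {poly C}}) :
  cvg_polys n P -> (forall k, (k < n)%N -> cvg (u s 'X^k @[s --> F])) ->
  cvg (u s (P s) @[s --> F]).
Proof.
move=> [sP cP] cu.
apply: (@near_cvg _ (fun s => \sum_(k < n) (P s)`_k * u s 'X^k)).
  apply: filterS sP => s sP.
  rewrite -{1}(coefK (P s)) poly_def raddf_sum/=.
  rewrite (big_ord_widen n (fun k => u s ((P s)`_k *: 'X^k)) sP) big_mkcond/=.
  apply: eq_bigr => k _; rewrite linearZ/=; case: ltnP => // kn.
  by rewrite nth_default// mul0r.
elim: n cu {sP} => [_|n IH cu].
  by under eq_fun do rewrite big_ord0; exact: is_cvg_cst.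
under eq_fun do rewrite big_ord_recr/=.
apply: is_cvgD; first by apply: IH => k kn; exact/cu/ltnW.
by apply: is_cvgM; [exact: cP|exact: cu].
Qed.

End ConvergentPolynomialFamilies.

(** * Convergence of the moments as the slope tends to zero *)

Section ConvergentLatticeOperators.
Variables (C : numClosedFieldType) (off : C) (F : set_system C).
Hypotheses (FF : Filter F) (F0 : F --> (0 : C)).
Hypothesis Fneq0 : \forall s \near F, s != 0.
Local Notation L s := (LinLattice s off).

(** The three bounds say that, up to lower order terms with convergent
    coefficients, [DX] and [SX] act on ['X^n] as the derivative and the
    identity. The derivative is compared after multiplication by ['X], which
    avoids the exponent [n - 1]. The three families are treated together since
    the product rules express each one at [n.+1] through the others at [n]. *)
Lemma cvg_polys_DX_SX n :
  [/\ cvg_polys F n (fun s => DX (L s) 'X^n),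
      cvg_polys F n (fun s => SX (L s) 'X^n - 'X^n) &
      cvg_polys F n (fun s => 'X * DX (L s) 'X^n - n%:R *: 'X^n)].
Proof.
have mono (k : nat) : cvg_polys F k.+1 (fun=> 'X^k : {poly C}).
  exact: cvg_polys_Xn.
have zero : cvg_polys F 0 (fun=> 0 : {poly C}).
  by have := cvg_polys_cst FF (0 : {poly C}); rewrite size_poly0.
elim: n => [|n [cD cS cE]].
  split; under [X in cvg_polys _ _ X]eq_fun do rewrite expr0.
  - by under [X in cvg_polys _ _ X]eq_fun do rewrite DX1.
  - by under [X in cvg_polys _ _ X]eq_fun do rewrite SX1 subrr.
  - by under [X in cvg_polys _ _ X]eq_fun do rewrite DX1 mulr0 scale0r subrr.
have cXS := cvg_polysMX FF cS.
have cXE := cvg_polysMX FF cE.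
have cXD := cvg_polysMX FF cD.
split.
- apply: (near_cvg_polys FF (Q := fun s => 'X * DX (L s) 'X^n +
    ((SX (L s) 'X^n - 'X^n) + 'X^n))).
    by apply: filterS Fneq0 => s s0; rewrite exprS DXMX// subrK.
  apply: cvg_polysD => //; apply: cvg_polysD => //.
  exact: cvg_polys_widen cS.
- apply: (near_cvg_polys FF (Q := fun s => 'X * (SX (L s) 'X^n - 'X^n) +
    (s / 2) ^+ 2 *: DX (L s) 'X^n)).
    apply: filterS Fneq0 => s s0; rewrite exprS SXMX//=.
    by rewrite mulrBr addrAC.
  apply: cvg_polysD => //; apply: cvg_polys_widen (leqnSn n) _ => //.
  apply: cvg_polysZ => //.
  have c2 : cvg (s / 2 @[s --> F]).
    by apply: is_cvgM; [apply/cvg_ex; exists 0|exact: is_cvg_cst].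
  by under eq_fun do rewrite expr2; exact: is_cvgM.
- apply: (near_cvg_polys FF (Q := fun s => 'X * ('X * DX (L s) 'X^n - n%:R *: 'X^n) +
    'X * (SX (L s) 'X^n - 'X^n))).
    apply: filterS Fneq0 => s s0; rewrite exprS DXMX//= -!mul_polyC.
    rewrite -natr1 polyCD polyC1; ring.
  exact: cvg_polysD.
Qed.

(** The polynomial on which the functional equation forces [u s] to vanish is
    [(a * n%:R + d) *: 'X^(n.+1)] plus terms of degree at most [n] with
    convergent coefficients: this is where the numbers [a * n%:R + d] arise. *)
Lemma cvg_polys_pearson (a b c d e : C) n :
  cvg_polys F n.+1 (fun s =>
    (a *: 'X^2 + b *: 'X + c%:P) * DX (L s) 'X^n
    + (d *: 'X + e%:P) * SX (L s) 'X^n - (a * n%:R + d) *: 'X^(n.+1)).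
Proof.
have [cD cS cE] := cvg_polys_DX_SX n.
have mono (k : nat) : cvg_polys F k.+1 (fun=> 'X^k : {poly C}).
  exact: cvg_polys_Xn.
have cst (l : C) : cvg (l @[_ --> F]) by exact: is_cvg_cst.
apply: (near_cvg_polys FF (Q := fun s =>
   (a *: ('X * ('X * DX (L s) 'X^n - n%:R *: 'X^n)) + b *: ('X * DX (L s) 'X^n)
   + d *: ('X * (SX (L s) 'X^n - 'X^n)))
   + (c *: DX (L s) 'X^n + (e *: (SX (L s) 'X^n - 'X^n) + e *: 'X^n)))).
  apply: nearW => s; rewrite [in 'X^(n.+1)]exprS expr2 -!mul_polyC.
  rewrite polyCD polyCM; ring.
have w P : cvg_polys F n P -> cvg_polys F n.+1 P by exact: cvg_polys_widen.
by do ?[apply: cvg_polysD => //]; apply: cvg_polysZ => //;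
  (exact: cvg_polysMX || exact: w).
Qed.

(** Testing the functional equation on ['X^n] expresses the moment of order
    [n.+1] through the lower ones, with division by [a * n%:R + d]; the moment
    of order 0 is constant, and induction on the order gives all the limits. *)
Lemma cvg_moments (a b c d e : C) (u : C -> poly_dual C) :
  (forall n : nat, a * n%:R + d != 0) ->
  (\forall s \near F, u s 1 = 1) ->
  (\forall s \near F,
     dual_DX (L s) (dual_mulp (a *: 'X^2 + b *: 'X + c%:P) (u s)) =
     dual_SX (L s) (dual_mulp (d *: 'X + e%:P) (u s))) ->
  forall p, cvg (u s p @[s --> F]).
Proof.
move=> dn0 u1 eqn.
(* strong induction: cvg_pairing uses all the lower moments at once *)
suff mom n k : (k < n)%N -> cvg (u s 'X^k @[s --> F]).
  move=> p; apply: (cvg_pairing FF (cvg_polys_cst FF p)) => k _.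
  exact: (mom k.+1).
elim: n k => // -[_ [|//] _|n IH k].
  apply: (near_cvg FF (g := fun=> 1)); last exact: is_cvg_cst.
  by apply: filterS u1 => s; rewrite expr0.
rewrite ltnS leq_eqVlt => /orP[/eqP ->|/IH//].
pose T s : {poly C} := (a *: 'X^2 + b *: 'X + c%:P) * DX (L s) 'X^n
  + (d *: 'X + e%:P) * SX (L s) 'X^n - (a * n%:R + d) *: 'X^(n.+1).
have cT : cvg (u s (T s) @[s --> F]).
  exact: cvg_pairing (cvg_polys_pearson a b c d e n) IH.
apply: (near_cvg FF (g := fun s => - (a * n%:R + d)^-1 * u s (T s))).
  apply: filterS eqn => s /(congr1 (fun v : poly_dual C => v 'X^n)).
  rewrite /dual_DX /dual_SX /= /dual_DX_fun /dual_SX_fun /dual_mulp/= /dual_mulp_fun.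
  move=> eqs; rewrite /T linearB linearD linearZ/= -eqs subrr ?sub0r.
  by rewrite mulrNN mulrA mulVf// mul1r.
by apply: is_cvgM => //; exact: is_cvg_cst.
Qed.

End ConvergentLatticeOperators.

(** * The weak topology of the dual *)

Section WeakTopology.
Variable C : numClosedFieldType.

(** The linearity proofs packed in a functional are propositions, hence they are
    irrelevant to its identity. *)
Lemma poly_dual_eq (v w : poly_dual C) : v =1 w -> v = w.
Proof.
move=> /funext; case: v w => [f [[cf] [df]]] [g [[cg] [dg]]] /= fg.
subst g.
by rewrite (Prop_irrelevance cf cg) (Prop_irrelevance df dg).
Qed.

Lemma poly_dual_cvgP I (F : set_system I) (FF : Filter F)
    (u : I -> poly_dual C) (v : poly_dual C) :
  u s @[s --> F] --> v <-> forall p, u s p @[s --> F] --> v p.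
Proof.
have ptwsP : poly_dual_eval (u s) @[s --> F] --> poly_dual_eval v <->
    forall p, u s p @[s --> F] --> v p.
  (* the topology on the index set has no influence on pointwise convergence *)
  exact: (@pointwise_cvgP (discrete_topology {poly C}) C).
rewrite -ptwsP; split=> [uv|uv].
  by apply: cvg_comp uv _; exact: (@initial_continuous _ _ (@poly_dual_eval C)).
move=> A [_ [[B oB <-] Bv] BA].
have := uv B (open_nbhs_nbhs (conj oB Bv)).
by rewrite !nbhs_simpl => uB; apply: (@filterS _ F FF _ _ _ uB) => s; exact: BA.
Qed.

(** Limits commute with linear combinations, so pointwise limits of functionals
    are functionals. *)
Lemma poly_dual_lim I (F : set_system I) (FF : ProperFilter F)
    (u : I -> poly_dual C) :
  (forall p, cvg (u s p @[s --> F])) ->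
  exists v : poly_dual C, forall p, v p = lim (u s p @[s --> F]).
Proof.
move=> cu; pose f p : C := lim (u s p @[s --> F]).
have f_scalar : scalar f.
  move=> k p q; apply: cvg_lim => //.
  under eq_fun do rewrite linearP.
  by apply: cvgD; [apply: cvgM; [exact: cvg_cst|exact: cu]|exact: cu].
pose fL := GRing.isLinear.Build C {poly C} C *%R f f_scalar.
pose v : {scalar {poly C}} := HB.pack f fL.
by exists v.
Qed.

End WeakTopology.

Theorem lemma6p1 (R : realType) (U : set (Cplx R)) (off : Cplx R)
    (a b c d e : Cplx R) (u : Cplx R -> poly_dual (Cplx R)) :
  let phi : {poly Cplx R} := a *: 'X^2 + b *: 'X + c%:P in
  let psi : {poly Cplx R} := d *: 'X + e%:P in
  (forall s, U s -> s != 0) ->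
  closure U 0 ->
  (forall s, U s -> u s <> \0 :> poly_dual (Cplx R)) ->
  (forall s, U s -> let X := LinLattice s off in
     dual_DX X (dual_mulp phi (u s)) = dual_SX X (dual_mulp psi (u s))) ->
  (forall n : nat, a * n%:R + d != 0) ->
  (forall s, U s -> u s 1 = 1) ->
  exists u0 : poly_dual (Cplx R),
    unique (fun v : poly_dual (Cplx R) =>
              u s @[s --> within U (nbhs 0)] --> v) u0 /\
    forall n : nat,
      cvg (u s 'X^n @[s --> within U (nbhs 0)]) /\
      u0 'X^n = lim (u s 'X^n @[s --> within U (nbhs 0)]).
Proof.
move=> phi psi U0 clU _ eqn dn0 u1.
have PF : ProperFilter (within U (nbhs (0 : Cplx R))) by exact: within_nbhs_proper.
have onU (P : Cplx R -> Prop) : (forall s, U s -> P s) ->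
    \forall s \near within U (nbhs 0), P s.
  by move=> UP; apply: filterS (withinT U (nbhs_filter 0)); exact: UP.
have cu : forall p, cvg (u s p @[s --> within U (nbhs 0)]).
  apply: (@cvg_moments _ off _ _ _ _ a b c d e) => //.
  - exact: cvg_within.
  - exact: onU.
  - exact: onU.
  - exact: onU.
have [u0 u0E] := poly_dual_lim PF cu.
exists u0; split; last by move=> n; split; [exact: cu|exact: u0E].
split=> [|v /poly_dual_cvgP uv].
  by apply/poly_dual_cvgP => p; rewrite u0E; exact: cu.
by apply: poly_dual_eq => p; rewrite u0E; exact: (cvg_lim (@norm_hausdorff _ _) (uv p)).
Qed.
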